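(* Let $\Lambda\subset\mathbb{C}$ be a lattice, let $\mathcal{A}=\mathbb{C}/\Lambda\times\mathbb{C}/\Lambda$, equipped with the reference metric $\omega_{\mathcal{A}}=dd^c|z_1|^2+dd^c|z_2|^2$, and let $\lambda\in\mathbb{R}\setminus\mathbb{Q}$ be an irrational number. Consider the holomorphic curve $f:\mathbb{C}\to\mathcal{A}$ given by $f(z)=([z],[\lambda z])$. Then any Ahlfors current $T$ of $f$ is diffuse.
   Context: Here $d^c=\frac{\sqrt{-1}}{4\pi}(\overline{\partial}-\partial)$, and $(z_1,z_2)$ are the coordinates on $\mathbb{C}^2$, the universal cover of $\mathcal{A}$. For a compact complex manifold $X$ with an area form $\omega$ (the positive $(1,1)$-form of a hermitian metric) and a nonconstant holomorphic map $f:\mathbb{C}\to X$, write $\mathbb{D}_r=\{z\in\mathbb{C}:|z|<r\}$, let $[f(\mathbb{D}_r)]=f_*[\mathbb{D}_r]$ be the current $\eta\mapsto\int_{\mathbb{D}_r}f^*\eta$, let $\mathrm{Area}_\omega(f(\mathbb{D}_r))=\int_{\mathbb{D}_r}f^*\omega$, and let $\mathrm{Length}_\omega(f(\partial\mathbb{D}_r))$ be the length of $f|_{\partial\mathbb{D}_r}$ for $\omega$. An Ahlfors current of $f$ is a positive closed current of bidimension $(1,1)$ on $X$ which is the weak limit of $[f(\mathbb{D}_{r_n})]/\mathrm{Area}_\omega(f(\mathbb{D}_{r_n}))$ for some sequence $r_n\nearrow\infty$ with $\mathrm{Length}_\omega(f(\partial\mathbb{D}_{r_n}))/\mathrm{Area}_\omega(f(\mathbb{D}_{r_n}))\to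 0$. In this statement $X=\mathcal{A}$ and $\omega=\omega_{\mathcal{A}}$. By Siu's theorem, such a $T$ decomposes as $T=T_{\mathrm{sing}}+T_{\mathrm{diff}}$, where $T_{\mathrm{sing}}=\sum_{\ell\in I}c_\ell[C_\ell]$ with $c_\ell>0$ and $C_\ell$ distinct irreducible algebraic curves ($I\subset\mathbb{Z}_+$, possibly empty), and $T_{\mathrm{diff}}$ is a positive closed current with zero Lelong number along every algebraic curve. $T$ is called diffuse if its singular part is trivial, $T_{\mathrm{sing}}=0$. *)

(* Defs.v *)
From HB Require Import structures.
From mathcomp Require Import all_boot all_order all_algebra complex.
From mathcomp Require Import all_classical all_reals all_analysis.

Set Implicit Arguments.
Unset Strict Implicit.
Unset Printing Implicit Defensive.

Import Order.TTheory GRing.Theory Num.Theory numFieldNormedType.Exports.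

Local Open Scope classical_set_scope.
Local Open Scope ring_scope.

(* [Rcomplex R] is the field R[i] with its real-valued modulus as norm; the
   library makes it an R-module and a normed group, and we add the induced
   topology, so that C and C * C are normed spaces over R and 'D_v, 'd,
   [continuous] below are the real notions. *)
Lemma Rcomplex_normrZ (R : realType) (l : R) (x : Rcomplex R) :
  `|l *: x| = `|l| * `|x|.
Proof.
case: x => a b; rewrite /Num.norm /= /ComplexField.scalec /=.
by rewrite !exprMn -mulrDr sqrtrM ?sqr_ge0// sqrtr_sqr.
Qed.

HB.instance Definition _ (R : realType) :=
  PseudoMetric.copy (Rcomplex R) (pseudoMetric_normed (Rcomplex R)).
HB.instance Definition _ (R : realType) := isPointed.Build (Rcomplex R) 0.
HB.instance Definition _ (R : realType) :=
  NormedZmod_PseudoMetric_eq.Build R (Rcomplex R) erefl.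
HB.instance Definition _ (R : realType) :=
  PseudoMetricNormedZmod_Lmodule_isNormedModule.Build R (Rcomplex R)
    (@Rcomplex_normrZ R).

Notation C R := (Rcomplex R).
Notation C2 R := (Rcomplex R * Rcomplex R)%type.

Definition toC (R : realType) (x : R * R) : C R := Complex x.1 x.2.
Definition iC (R : realType) : C R := Complex 0 1.
Definition mulI (R : realType) (z : C R) : C R := iC R * z.
Definition mulI2 (R : realType) (v : C2 R) : C2 R := (mulI v.1, mulI v.2).

Definition is_lattice (R : realType) (L : set (C R)) : Prop :=
  exists w1 w2 : C R,
    (forall a b : R, a *: w1 + b *: w2 = 0 -> a = 0 /\ b = 0) /\
    L = [set z | exists m n : int, z = w1 *~ m + w2 *~ n].

(* The torus A = C/L x C/L is handled through its universal cover C^2: the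
   functions and forms on A are the (L x L)-periodic ones on C^2, the subsets
   of A are the (L x L)-invariant subsets of C^2, and an entire curve in A is
   given by a lift C -> C^2 (which exists because C is simply connected). *)

Definition periodic (R : realType) (L : set (C R)) (X : Type)
    (u : C2 R -> X) : Prop :=
  forall p l : C2 R, (L `*` L) l -> u (p + l) = u p.

Fixpoint Ck (R : realType) (V : normedModType R) (n : nat) (u : V -> R)
    : Prop :=
  continuous u /\
  match n with
  | 0 => True
  | m.+1 => forall v : V,
      (forall x : V, derivable u x v) /\ Ck m (fun x => 'D_v u x)
  end.

Definition smooth (R : realType) (V : normedModType R) (u : V -> R) : Prop :=
  forall n, Ck n u.

(* All iterated derivatives of u of order at most n along vectors of norm at most 1 are
   bounded by M. *)
Fixpoint Ck_bounded (R : realType) (V : normedModType R) (n : nat) (M : R)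
    (u : V -> R) : Prop :=
  (forall x : V, `|u x| <= M) /\
  match n with
  | 0 => True
  | m.+1 => forall v : V, `|v| <= 1 -> Ck_bounded m M (fun x => 'D_v u x)
  end.

Definition test_fun (R : realType) (L : set (C R)) (u : C2 R -> R) : Prop :=
  smooth u /\ periodic L u.

(* Real differential forms on C^2, as functions of the base point and of
   tangent vectors. *)
Notation form1 R := (C2 R -> C2 R -> R).
Notation form2 R := (C2 R -> C2 R -> C2 R -> R).

Definition test_form1 (R : realType) (L : set (C R)) (b : form1 R) : Prop :=
  (forall p, linear (b p : C2 R -> R^o)) /\
  (forall v, test_fun L (fun p => b p v)).

Definition test_form2 (R : realType) (L : set (C R)) (eta : form2 R) : Prop :=
  [/\ forall p w, linear (fun v : C2 R => eta p v w : R^o),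
      forall p v w, eta p v w = - eta p w v
    & forall v w, test_fun L (fun p => eta p v w)].

Definition ext_d (R : realType) (b : form1 R) : form2 R :=
  fun p v w => 'D_v (fun q => b q w) p - 'D_w (fun q => b q v) p.

(* d^c = (i / 4 pi) (dbar - d'): as (dbar u - d' u)(v) = i du(i v), this is
   d^c u (v) = - (1 / 4 pi) du(i v). *)
Definition d_c (R : realType) (u : C2 R -> R) : form1 R :=
  fun p v => - (4 * pi)^-1 * 'D_(mulI2 v) u p.

Definition omegaA (R : realType) : form2 R := fun p v w =>
  ext_d (d_c (fun z : C2 R => `|z.1| ^+ 2)) p v w +
  ext_d (d_c (fun z : C2 R => `|z.2| ^+ 2)) p v w.

Definition type_11 (R : realType) (eta : form2 R) : Prop :=
  forall p v w, eta p (mulI2 v) (mulI2 w) = eta p v w.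

(* The real forms which are sums of a (2,0)- and a (0,2)-form. *)
Definition type_20_02 (R : realType) (eta : form2 R) : Prop :=
  forall p v w, eta p (mulI2 v) (mulI2 w) = - eta p v w.

Definition positive_form (R : realType) (eta : form2 R) : Prop :=
  type_11 eta /\ forall p v, 0 <= eta p v (mulI2 v).

(* A positive current is real, so it is given by its values on real forms.
   Only the values on test forms are meaningful. *)

Notation functional R := (form2 R -> R).

Definition is_current (R : realType) (L : set (C R)) (T : functional R)
    : Prop :=
  (forall (a : R) (eta theta : form2 R),
     test_form2 L eta -> test_form2 L theta ->
     T (fun p v w => a * eta p v w + theta p v w) = a * T eta + T theta) /\
  (exists (n : nat) (K : R), forall (eta : form2 R) (M : R),
     test_form2 L eta ->
     (forall v w, `|v| <= 1 -> `|w| <= 1 ->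
        Ck_bounded n M (fun p => eta p v w)) ->
     `|T eta| <= K * M).

Definition bidimension_11 (R : realType) (L : set (C R)) (T : functional R)
    : Prop :=
  forall eta, test_form2 L eta -> type_20_02 eta -> T eta = 0.

Definition positive_current (R : realType) (L : set (C R)) (T : functional R)
    : Prop :=
  forall eta, test_form2 L eta -> positive_form eta -> 0 <= T eta.

Definition closed_current (R : realType) (L : set (C R)) (T : functional R)
    : Prop :=
  forall b, test_form1 L b -> T (ext_d b) = 0.

Definition positive_closed_11 (R : realType) (L : set (C R))
    (T : functional R) : Prop :=
  [/\ is_current L T, bidimension_11 L T, positive_current L T
    & closed_current L T].

Definition mu1 (R : realType) := @lebesgue_measure R.
Definition mu2 (R : realType) := (@mu1 R \x @mu1 R)%E.

Definition pullback (R : realType) (F : C R -> C2 R) (eta : form2 R)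
    (z a b : C R) : R :=
  eta (F z) ('D_a F z) ('D_b F z).

(* The integral of F^* eta over a subset of C, i.e. of its dx /\ dy
   coefficient. *)
Definition integral_form (R : realType) (E : set (R * R)) (F : C R -> C2 R)
    (eta : form2 R) : R :=
  \int[@mu2 R]_(x in E) pullback F eta (toC x) 1 (iC R).

Definition disc (R : realType) (r : R) : set (R * R) :=
  [set x | `|toC x| < r].

Definition disc_current (R : realType) (F : C R -> C2 R) (r : R)
    : functional R :=
  fun eta => integral_form (disc r) F eta.

Definition area (R : realType) (F : C R -> C2 R) (r : R) : R :=
  disc_current F r (@omegaA R).

Definition boundary_path (R : realType) (F : C R -> C2 R) (r : R)
    : R -> C2 R :=
  fun t => F (r *: toC (cos t, sin t)).

(* The hermitian metric with area form omega has Riemannian norm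
   |v|^2 = omega(v, i v). *)
Definition boundary_length (R : realType) (F : C R -> C2 R) (r : R) : R :=
  let g := boundary_path F r in
  \int[@mu1 R]_(t in `[0, 2 * pi])
    Num.sqrt (omegaA (g t) (derive1 g t) (mulI2 (derive1 g t))).

Definition ahlfors_current (R : realType) (L : set (C R)) (F : C R -> C2 R)
    (T : functional R) : Prop :=
  positive_closed_11 L T /\
  exists r : nat -> R,
    [/\ forall n, 0 < r n,
        nondecreasing_seq r,
        r n @[n --> \oo] --> +oo,
        boundary_length F (r n) / area F (r n) @[n --> \oo] --> (0 : R)
      & forall eta, test_form2 L eta ->
          disc_current F (r n) eta / area F (r n) @[n --> \oo] --> T eta].

(* The preimage in C^2 of the image in A of the Euclidean ball of C^2. *)
Definition torus_ball (R : realType) (L : set (C R)) (x : C2 R) (r : R)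
    : set (C2 R) :=
  [set p | exists2 l, (L `*` L) l &
     `|p.1 - x.1 - l.1| ^+ 2 + `|p.2 - x.2 - l.2| ^+ 2 < r ^+ 2].

(* The mass on the open set U of the trace measure T /\ omega of a positive
   current T. *)
Definition trace_mass (R : realType) (L : set (C R)) (T : functional R)
    (U : set (C2 R)) : R :=
  sup [set m | exists chi : C2 R -> R,
    [/\ test_fun L chi, forall p, 0 <= chi p <= 1,
        closure [set p | chi p != 0] `<=` U
      & m = T (fun p v w => chi p * omegaA p v w)]].

(* As dd^c |z|^2 = (1 / pi) dx /\ dy, no further normalisation is needed for
   the current of a complex line to have Lelong number 1 at its points. *)
Definition lelong (R : realType) (L : set (C R)) (T : functional R)
    (x : C2 R) : R :=
  lim (trace_mass L T (torus_ball L x r) / r ^+ 2 @[r --> (0 : R)^'+]).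

(* The generic Lelong number along Z. *)
Definition lelong_along (R : realType) (L : set (C R)) (T : functional R)
    (Z : set (C2 R)) : R :=
  inf [set lelong L T x | x in Z].

(* A is projective, so by Chow's theorem its algebraic subsets are its analytic
   subsets. *)

Definition holomorphic_at (R : realType) (V W : normedModType R)
    (iV : V -> V) (iW : W -> W) (g : V -> W) (p : V) : Prop :=
  differentiable g p /\ forall v, 'd g p (iV v) = iW ('d g p v).

Definition holomorphic_fun (R : realType) (U : set (C2 R)) (g : C2 R -> C R)
    : Prop :=
  forall p, U p -> holomorphic_at (@mulI2 R) (@mulI R) g p.

Definition holomorphic_curve (R : realType) (U : set (C R)) (F : C R -> C2 R)
    : Prop :=
  forall z, U z -> holomorphic_at (@mulI R) (@mulI2 R) F z.

Definition analytic_subset (R : realType) (L : set (C R)) (Z : set (C2 R))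
    : Prop :=
  periodic L Z /\
  forall p, exists (U : set (C2 R)) (n : nat) (g : 'I_n -> C2 R -> C R),
    [/\ open U, U p, forall i, holomorphic_fun U (g i)
      & Z `&` U = [set q | U q /\ forall i, g i q = 0]].

Definition irreducible (R : realType) (L : set (C R)) (Z : set (C2 R))
    : Prop :=
  Z !=set0 /\
  forall Z1 Z2, analytic_subset L Z1 -> analytic_subset L Z2 ->
    Z = Z1 `|` Z2 -> Z = Z1 \/ Z = Z2.

(* The points near which Z is a complex submanifold of dimension 1. *)
Definition regular_points (R : realType) (Z : set (C2 R)) : set (C2 R) :=
  [set p | Z p /\ exists (U : set (C2 R)) (g : C2 R -> C R),
     [/\ open U, U p, holomorphic_fun U g, exists v, 'd g p v != 0
       & Z `&` U = [set q | U q /\ g q = 0]]].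

(* An irreducible analytic subset has the dimension of its regular locus. *)
Definition algebraic_curve (R : realType) (L : set (C R)) (Z : set (C2 R))
    : Prop :=
  [/\ analytic_subset L Z, irreducible L Z & regular_points Z !=set0].

(* B is the current [Z] : eta |-> \int_(Z_reg) eta.  The integral over the
   Riemann surface Z_reg (in A) is computed by cutting Z_reg into countably
   many disjoint measurable pieces phi k (E k), each the injective image under
   a holomorphic map of a measurable subset of C. *)
Definition integration_current (R : realType) (L : set (C R))
    (Z : set (C2 R)) (B : functional R) : Prop :=
  exists (E : nat -> set (measurableTypeR R * measurableTypeR R))
         (phi : nat -> C R -> C2 R),
    [/\ forall k, measurable (E k),
        forall k, exists U : set (C R),
          [/\ open U, holomorphic_curve U (phi k)
            & forall x, E k x -> U (toC x)],
        forall k x, E k x -> regular_points Z (phi k (toC x)),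
        forall p, regular_points Z p ->
          exists! kx : nat * (R * R),
            E kx.1 kx.2 /\ (L `*` L) (p - phi kx.1 (toC kx.2))
      & forall eta, test_form2 L eta ->
          (forall k, (@mu2 R).-integrable (E k)
             (EFin \o (fun x => pullback (phi k) eta (toC x) 1 (iC R)))) /\
          series (fun k => integral_form (E k) (phi k) eta) @ \oo --> B eta].

Definition siu_decomposition (R : realType) (L : set (C R))
    (T Tsing Tdiff : functional R) : Prop :=
  (forall eta, test_form2 L eta -> T eta = Tsing eta + Tdiff eta) /\
  (exists (I : set nat) (c : nat -> R) (Z : nat -> set (C2 R))
          (B : nat -> functional R),
     [/\ forall l, I l -> 0 < c l,
         forall l, I l ->
           algebraic_curve L (Z l) /\ integration_current L (Z l) (B l),
         forall l m, I l -> I m -> Z l = Z m -> l = m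
       & forall eta, test_form2 L eta ->
           (\sum_(0 <= l < n | l \in I) c l * B l eta) @[n --> \oo]
             --> Tsing eta]) /\
  positive_closed_11 L Tdiff /\
  (forall Z, algebraic_curve L Z -> lelong_along L Tdiff Z = 0).

(* By Siu's theorem the decomposition of a positive closed current is unique,
   so that this says that its singular part is zero. *)
Definition diffuse (R : realType) (L : set (C R)) (T : functional R) : Prop :=
  exists Tsing Tdiff : functional R,
    siu_decomposition L T Tsing Tdiff /\
    forall eta, test_form2 L eta -> Tsing eta = 0.

(* Main.v *)
From HB Require Import structures.
Require Import Defs.
From mathcomp Require Import all_boot all_order all_algebra complex.
From mathcomp Require Import all_classical all_reals all_analysis.
From mathcomp Require Import measurable_realfun.
From mathcomp Require Import ring lra zify.

Set Implicit Arguments.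
Unset Strict Implicit.
Unset Printing Implicit Defensive.

Import Order.TTheory GRing.Theory Num.Theory numFieldNormedType.Exports.
Local Open Scope classical_set_scope.
Local Open Scope ring_scope.

(** A current T obtained from f carries no mass on curves because f returns to
    a small ball of the torus too rarely.  If chi is a cutoff function
    supported in the ball of radius e around x, then T (chi omega) is the limit
    of the averages of chi (z, lam z) over large discs |z| < r, since both the
    area of f and the pullback of chi omega have a constant factor
    (1 + lam^2) / pi in front of Lebesgue measure ([pullback_omegaA],
    [area_line]).  So the trace mass of that ball is at most the density of the
    set of z with (z, lam z) in it.

    The density is bounded by packing.  In the real coordinates (a, b) of C
    dual to a basis (w1, w2) of the lattice, a visit z to the ball makes the
    numbers a(z) - a(x1), b(z) - b(x1) and lam a(z) - a(x2) lie within
    d = O(e) of the integers ([torus_ball_visits]).  Translate the set of visits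
    by i h w1 + j h w2 + k w1 with h = 2 d, 0 <= i, j < 1 / (2 h) and 0 <= k < N.
    The first two conditions tell (i, j) from the translated set, and the third
    one tells k, as soon as no multiple lam m with 0 < m < N is within 2 d of an
    integer; irrationality of lam makes this true for small e.  These
    translates are therefore disjoint, there are about N / (16 d^2) of them,
    and they all fit in a slightly larger disc: the density is O(e^2) / N
    ([visits_packing], [visits_density]).

    The trace mass of the ball, divided by e^2, is thus at most a constant over
    N for e small, with N arbitrary.  Hence every Lelong number of T is zero
    ([lelong_eq0]), and T is its own diffuse part: the decomposition with no
    curve at all is the Siu decomposition of T. *)

(** * The area form along the line z |-> (z, lam z) *)

(** All functions differentiated here are polynomial of degree at most two
    along lines, so that their derivatives can be read off an expansion. *)
Lemma derive_second_order (R : realType) (V W : normedModType R) (f : V -> W)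
    (x v : V) (a b : W) :
  (forall h : R, f (h *: v + x) = f x + h *: a + h ^+ 2 *: b) ->
  'D_v f x = a.
Proof.
move=> fE.
have cv : h^-1 *: (f (h *: v + x) - f x) @[h --> (0 : R)^'] --> a.
  apply: (@cvg_trans _ ((fun h : R => a + h *: b) @ (0 : R)^')).
    apply: near_eq_cvg; near=> h.
    have h0 : h != 0 by near: h; exact: nbhs_dnbhs_neq.
    rewrite fE -(addrA (f x)) (addrC (f x)) addrK scalerDr !scalerA mulVf// scale1r expr2.
    by rewrite mulKf.
  suff : (fun h : R => a + h *: b) @ (0 : R)^' --> a + 0 *: b.
    by rewrite scale0r addr0.
  apply: cvgD; first exact: cvg_cst.
  by apply: cvgZr_tmp; exact: nbhs_dnbhs.
exact: cvg_lim.
Unshelve. all: by end_near. Qed.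

Definition area_form (R : realType) (z w : C R) : R :=
  complex.Re z * complex.Im w - complex.Im z * complex.Re w.

Lemma ReImE (R : realType) :
  (forall z w : C R, complex.Re (z + w) = complex.Re z + complex.Re w) *
  (forall z w : C R, complex.Im (z + w) = complex.Im z + complex.Im w) *
  (forall (a : R) (z : C R), complex.Re (a *: z) = a * complex.Re z) *
  (forall (a : R) (z : C R), complex.Im (a *: z) = a * complex.Im z) *
  (forall z : C R, complex.Re (mulI z) = - complex.Im z) *
  (forall z : C R, complex.Im (mulI z) = complex.Re z).
Proof.
do !split.
- by case=> a b [c d].
- by case=> a b [c d].
- by move=> a [b c].
- by move=> a [b c].
- by case=> a b; rewrite /mulI/= -[LHS]/(0 * a - 1 * b) mul0r mul1r sub0r.
- by case=> a b; rewrite /mulI/= -[LHS]/(0 * b + 1 * a) mul0r mul1r add0r.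
Qed.

Lemma ReImB (R : realType) :
  (forall z w : C R, complex.Re (z - w) = complex.Re z - complex.Re w) *
  (forall z w : C R, complex.Im (z - w) = complex.Im z - complex.Im w).
Proof. by split; case=> a b [c d]. Qed.

Lemma normC_sqr (R : realType) (z : C R) :
  `|z| ^+ 2 = complex.Re z ^+ 2 + complex.Im z ^+ 2.
Proof.
by case: z => a b; rewrite /Num.norm /= sqr_sqrtr// addr_ge0// sqr_ge0.
Qed.

Lemma derive_normC_sqr (R : realType) (p : C2 R -> C R) (q v : C2 R) :
  linear (p : C2 R -> C R) ->
  'D_v (fun z => `|p z| ^+ 2) q =
    2 * (complex.Re (p q) * complex.Re (p v) + complex.Im (p q) * complex.Im (p v)).
Proof.
move=> pl.
apply: (@derive_second_order _ _ R^o _ _ _ _ (`|p v| ^+ 2)) => h.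
rewrite pl !normC_sqr !ReImE /GRing.scale/=; ring.
Qed.

(** The map p stands for either projection of C^2; this is the identity
    dd^c |z|^2 = dx /\ dy / pi. *)
Lemma ext_d_d_c_normC_sqr (R : realType) (p : C2 R -> C R) (q v w : C2 R) :
  linear (p : C2 R -> C R) -> (forall v, p (mulI2 v) = mulI (p v)) ->
  ext_d (d_c (fun z => `|p z| ^+ 2)) q v w = pi^-1 * area_form (p v) (p w).
Proof.
move=> pl pI.
(* [pi] is generalized below: [field] would unfold it. *)
have pi0 : pi != 0 :> R by rewrite gt_eqF// pi_gt0.
have dE (a b r : C2 R) : 'D_a (d_c (fun z => `|p z| ^+ 2) ^~ b) r =
    (2 * pi)^-1 * area_form (p a) (p b).
  apply: (@derive_second_order _ _ R^o _ _ _ _ 0) => h.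
  rewrite /d_c !derive_normC_sqr// !pI pl scaler0 addr0 /area_form.
  rewrite !ReImE /GRing.scale/=.
  by move: (@pi R) pi0 => c c0; field.
rewrite /ext_d !dE /area_form.
by move: (@pi R) pi0 => c c0; field.
Qed.

Lemma omegaAE (R : realType) (q v w : C2 R) :
  omegaA q v w = pi^-1 * (area_form v.1 w.1 + area_form v.2 w.2).
Proof. by rewrite /omegaA !ext_d_d_c_normC_sqr ?mulrDr. Qed.

Lemma derive_line (R : realType) (lam : R) (a z : C R) :
  'D_a (fun z : C R => (z, lam *: z)) z = (a, lam *: a).
Proof.
apply: (@derive_second_order _ _ _ _ _ _ _ 0) => h.
rewrite scaler0 addr0 /=; congr pair => /=; first exact: addrC.
by rewrite scalerDr addrC !scalerA mulrC.
Qed.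

Lemma pullback_omegaA (R : realType) (lam : R) (chi : C2 R -> R) (z : C R) :
  pullback (fun z : C R => (z, lam *: z))
    (fun p v w => chi p * omegaA p v w) z 1 (iC R) =
  chi (z, lam *: z) * (pi^-1 * (1 + lam ^+ 2)).
Proof.
rewrite /pullback !derive_line omegaAE /area_form/=; ring.
Qed.

(** As [omegaA] has constant coefficients, chi omega has the same regularity as
    chi; these are the forms that define the trace mass. *)
Lemma test_form2_omegaA (R : realType) (L : set (C R)) (chi : C2 R -> R) :
  test_fun L chi -> test_form2 L (fun p v w => chi p * omegaA p v w).
Proof.
have Ck_scale n (a : R) : forall u : C2 R -> R, Ck n u -> Ck n (fun x => a * u x).
  elim: n => [|n IH] u [cu uD].
    by split=> // x; apply: cvgMr; exact: cu.
  split; first by move=> x; apply: cvgMr; exact: cu.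
  move=> v; have [du {}/IH uD'] := uD v; split.
    by move=> x; apply: (@derivableZ _ _ R^o).
  apply: eq_ind uD' _ _; apply/funext => x.
  by rewrite (@deriveZ _ _ R^o).
move=> [su pu]; split=> [p w a v v'|p v w|v w].
- by rewrite !omegaAE /area_form /GRing.scale/= !ReImE; ring.
- by rewrite !omegaAE /area_form; ring.
- have -> : (fun p => chi p * omegaA p v w) = (fun p => omegaA 0 v w * chi p).
    by apply/funext => p; rewrite !omegaAE mulrC.
  by split=> [n|p l Ll]; [apply: Ck_scale; exact: su | rewrite pu].
Qed.

(** * Translations and packing in the plane *)

HB.instance Definition _ (R : realType) :=
  Measure.copy (@mu2 R) (@mu1 R \x @mu1 R)%E.

Section measure.
Context {R : realType}.
Local Notation T2 := (measurableTypeR R * measurableTypeR R)%type.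

Lemma measurable_translate (s : R) :
  measurable_fun setT ((fun x => x + s) : measurableTypeR R -> measurableTypeR R).
Proof.
by apply: measurable_funD; [exact: measurable_id|exact: measurable_cst].
Qed.

Lemma mu1_translate (s : R) (A : set (measurableTypeR R)) : measurable A ->
  lebesgue_measure ((fun x => x + s) @^-1` A) = lebesgue_measure A.
Proof.
pose f : measurableTypeR R -> measurableTypeR R := fun x => x + s.
have mf : measurable_fun setT f by exact: measurable_translate.
move=> mA; symmetry.
apply: (@lebesgue_measure_unique R (pushforward (@lebesgue_measure R) f)) mA.
move=> _ /= [[a b] _ <-].
rewrite /pushforward.
have -> : f @^-1` `]a, b]%classic = `]a - s, b - s]%classic.
  by apply/seteqP; split=> x /=; rewrite !in_itv/= /f ltrBlDr lerBrDr.
rewrite !lebesgue_measure_itv/= !lte_fin ltrD2r; case: ifP => // _.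
by rewrite -!EFinB; congr EFin; ring.
Qed.

Lemma mu2_translate (s : R * R) (A : set T2) : measurable A ->
  (@mu2 R) ((fun x => (x.1 + s.1, x.2 + s.2)) @^-1` A) = (@mu2 R) A.
Proof.
pose f : T2 -> T2 := fun x => (x.1 + s.1, x.2 + s.2).
have mf : measurable_fun setT f.
  apply: measurable_fun_pair; apply: measurable_funD => //.
move=> mA; symmetry.
apply: (@product_measure_unique _ _ _ _ R (@mu1 R) (@mu1 R)
  (pushforward (@mu2 R) f)) => // X Y mX mY.
rewrite /= /pushforward /mu2.
have -> : f @^-1` (X `*` Y) =
    ((fun x => x + s.1) @^-1` X) `*` ((fun x => x + s.2) @^-1` Y) by [].
have mS (t : R) (Z : set (measurableTypeR R)) : measurable Z ->
    measurable ((fun x => x + t) @^-1` Z : set (measurableTypeR R)).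
  move=> mZ; rewrite -[X in measurable X]setTI.
  exact: (measurable_translate t measurableT mZ).
rewrite product_measure1E; [|exact: mS|exact: mS].
by congr (_ * _)%E; exact: mu1_translate.
Qed.

(** By translation invariance each of the disjoint translates of B in S has the
    measure of B. *)
Lemma mu2_packing (I : finType) (s : I -> R * R) (B S : set T2) :
  measurable B -> measurable S ->
  (forall i j x, B (x.1 + (s i).1, x.2 + (s i).2) ->
                 B (x.1 + (s j).1, x.2 + (s j).2) -> i = j) ->
  (forall i x, B (x.1 + (s i).1, x.2 + (s i).2) -> S x) ->
  (#|I|%:R%:E * @mu2 R B <= @mu2 R S)%E.
Proof.
move=> mB mS dis sub.
pose f i : T2 -> T2 := fun x => (x.1 + (s i).1, x.2 + (s i).2).
have mf i : measurable (f i @^-1` B).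
  rewrite -[X in measurable X]setTI.
  suff mfi : measurable_fun setT (f i) by exact: mfi.
  apply: measurable_fun_pair.
    exact: (measurableT_comp (measurable_translate _)).
  exact: (measurableT_comp (measurable_translate _)).
have <- : (@mu2 R (\bigcup_(i in [set` enum I]) f i @^-1` B) = #|I|%:R%:E * @mu2 R B)%E.
  rewrite measure_fin_bigcup//; last first.
    by apply/trivIsetP => i j _ _ ij; apply/eqP/negPn/negP => /set0P[x [Bi Bj]];
      rewrite (dis _ _ _ Bi Bj) eqxx in ij.
  rewrite -fsbig_seq ?enum_uniq// big_enum/=.
  under eq_bigr do rewrite mu2_translate//.
  rewrite mule_natl big_const; elim: #|I| => [//|n IH].
  by rewrite iterS IH; case: n {IH} => [|n]; rewrite ?adde0.
apply: (@le_measure _ _ _ (@mu2 R)); rewrite ?inE//.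
  exact: fin_bigcup_measurable.
by move=> x [i _ Bx]; exact: sub Bx.
Qed.

End measure.

(** * Discs

    Only the order of magnitude of the area of a disc matters, so discs are
    compared with squares. *)

Section disc.
Context {R : realType}.
Local Notation T2 := (measurableTypeR R * measurableTypeR R)%type.

Lemma normC_ltE (z : C R) (r : R) : 0 < r ->
  (`|z| < r) = (complex.Re z ^+ 2 + complex.Im z ^+ 2 < r ^+ 2).
Proof. by move=> r0; rewrite -normC_sqr ltr_pXn2r// ?nnegrE// ltW. Qed.

Lemma measurable_disc (r : R) : 0 < r -> measurable (disc r : set T2).
Proof.
move=> r0.
have -> : disc r = [set x : T2 | x.1 ^+ 2 + x.2 ^+ 2 < r ^+ 2].
  by apply/seteqP; split=> x; rewrite /disc/= normC_ltE.
rewrite -[X in measurable X]setTI.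
apply: (measurable_fun_ltr _ (measurable_cst _)) => //.
by apply: measurable_funD; apply: measurable_funX.
Qed.

Lemma measurable_square (a : R) : measurable (`[-a, a] `*` `[-a, a] : set T2).
Proof. by apply: measurableX. Qed.

Lemma mu2_square (a : R) : 0 < a ->
  @mu2 R (`[-a, a] `*` `[-a, a]) = ((2 * a) ^+ 2)%:E.
Proof.
move=> a0; rewrite /mu2 product_measure1E//= /mu1 lebesgue_measure_itv/= lte_fin.
by rewrite gtrN// -EFinB -EFinM; congr EFin; ring.
Qed.

Lemma mu2_disc_le (r : R) : 0 < r -> (@mu2 R (disc r) <= ((2 * r) ^+ 2)%:E)%E.
Proof.
move=> r0; rewrite -mu2_square//.
apply: (@le_measure _ _ _ (@mu2 R)); rewrite ?inE//.
- exact: measurable_disc.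
- exact: measurable_square.
move=> [a b]; rewrite /disc/= normC_ltE//= !in_itv/= => ab.
by split; nra.
Qed.

Lemma mu2_disc_ge (r : R) : 0 < r -> ((r ^+ 2)%:E <= @mu2 R (disc r))%E.
Proof.
move=> r0; have -> : r ^+ 2 = (2 * (r / 2)) ^+ 2 by congr (_ ^+ 2); field.
rewrite -mu2_square ?divr_gt0//.
apply: (@le_measure _ _ _ (@mu2 R)); rewrite ?inE//.
- exact: measurable_square.
- exact: measurable_disc.
move=> [a b]; rewrite /disc/= normC_ltE//= !in_itv/= => -[/andP[? ?] /andP[? ?]].
by nra.
Qed.

Lemma mu2_disc_fin_num (r : R) : 0 < r -> @mu2 R (disc r) \is a fin_num.
Proof.
move=> r0; rewrite ge0_fin_numE; last exact: measure_ge0.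
by rewrite (le_lt_trans (mu2_disc_le r0))// ltry.
Qed.

Lemma mu2_setI_disc_fin_num (A : set T2) (r : R) : 0 < r -> measurable A ->
  @mu2 R (A `&` disc r) \is a fin_num.
Proof.
move=> r0 mA; have mD := measurable_disc r0.
rewrite ge0_fin_numE ?measure_ge0//; apply: (@le_lt_trans _ _ (@mu2 R (disc r))).
  by apply: (@le_measure _ _ _ (@mu2 R)); rewrite ?inE//; exact: measurableI.
by rewrite -ge0_fin_numE ?measure_ge0// mu2_disc_fin_num.
Qed.

End disc.

(** The integral of a nonnegative function is a supremum over the simple
    functions below it, hence monotone even for functions that are not known to
    be measurable. *)
Lemma ge0_le_integral_nomeas d (T : measurableType d) (R : realType)
    (mu : {measure set T -> \bar R}) (D : set T) (f g : T -> \bar R) :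
  (forall x, D x -> (0 <= f x)%E) -> (forall x, D x -> (f x <= g x)%E) ->
  (\int[mu]_(x in D) f x <= \int[mu]_(x in D) g x)%E.
Proof.
move=> f0 fg.
rewrite !ge0_integralE//; last by move=> x Dx; rewrite (le_trans (f0 x Dx))// fg.
apply: ereal_sup_le => _ [h hf <-]; exists h => // x.
rewrite (le_trans (hf x))// /patch; case: ifPn => // /set_mem; exact: fg.
Qed.

(** * Distance to the integers *)

Definition near_int (R : realType) (d t : R) : Prop :=
  exists m : int, `|t - m%:~R| < d.

Lemma near_int_sub (R : realType) (d s t : R) :
  near_int d s -> near_int d t -> near_int (2 * d) (s - t).
Proof.
move=> [m sm] [n tn]; exists (m - n).
have -> : s - t - (m - n)%:~R = (s - m%:~R) - (t - n%:~R) by rewrite intrB; ring.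
by rewrite (le_lt_trans (ler_normB _ _))// mulr_natl mulr2n ltrD.
Qed.

Lemma measurable_near_int (R : realType) (d : R) :
  measurable ([set t | near_int d t] : set (measurableTypeR R)).
Proof.
have -> : [set t : R | near_int d t] =
    \bigcup_(m : int) `]m%:~R - d, m%:~R + d[%classic.
  apply/seteqP; split=> t /=.
    by case=> m; rewrite ltr_distl => tm; exists m => //=; rewrite in_itv/=.
  by case=> m _ /=; rewrite in_itv/= -ltr_distl => tm; exists m.
by apply: countable_bigcupT_measurable => // m; exact: measurable_itv.
Qed.

Lemma intr_small (R : realType) (m : int) : `|m%:~R : R| < 1 -> m = 0.
Proof. by rewrite -intr_norm -[1](mulr1z) ltr_int; lia. Qed.

Lemma near_int_le (R : realType) (d e t : R) :
  d <= e -> near_int d t -> near_int e t.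
Proof. by move=> de [m tm]; exists m; exact: lt_le_trans de. Qed.

(** Distinct points of a grid of mesh h in [0, 1/2[ are at distance at least h, and
    at most 1/2 - h from each other, so their difference is at distance at least
    h from every integer. *)
Lemma near_int_grid (R : realType) (J : nat) (h : R) (i j : nat) (n : int) :
  J%:R * h <= 2^-1 -> (i < J)%N -> (j < J)%N ->
  near_int h (i%:R * h - j%:R * h + n%:~R) -> i = j.
Proof.
move=> Jh iJ jJ [m ijm].
have h0 : 0 < h by exact: le_lt_trans ijm.
have grid k : (k < J)%N -> 0 <= k%:R * h <= 2^-1 - h.
  move=> kJ; rewrite mulr_ge0 ?(ltW h0)//= lerBrDr -[X in _ + X]mul1r -mulrDl.
  by apply: le_trans Jh; rewrite ler_pM2r// natr1 ler_nat.
have /andP[i0 i1] := grid i iJ; have /andP[j0 j1] := grid j jJ.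
have mn : m - n = 0.
  apply: (@intr_small R); rewrite intrB.
  by move: ijm; rewrite !ltr_norml => /andP[? ?]; apply/andP; split; lra.
have {}mn : m = n by apply/eqP; rewrite -subr_eq0 mn.
move: ijm; rewrite mn addrK -mulrBl normrM (gtr0_norm h0) gtr_pMl//.
by move=> ij; have := @intr_small R (i%:Z - j%:Z); rewrite intrB => /(_ ij); lia.
Qed.

(** Each of these finitely many multiples is irrational, so it has a positive
    distance to the integers. *)
Lemma irrational_multiples_away (R : realType) (lam : R) (N : nat) :
  irrational lam ->
  exists2 d : R, 0 < d & forall k : nat, (0 < k < N)%N -> ~ near_int d (lam * k%:R).
Proof.
move=> lamQ; elim: N => [|N [d d0 dN]]; first by exists 1 => // k; rewrite ltn0 andbF.
have [->|N0] := posnP N; first by exists 1 => // k; case: k.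
set t := lam * N%:R; set m := Num.floor t.
have mt : m%:~R < t.
  rewrite lt_neqAle floor_le andbT; apply/eqP => mt; apply: lamQ.
  by apply/rationalP; exists m, N; rewrite mt mulfK// pnatr_eq0 -lt0n.
have tm : t < m%:~R + 1 by rewrite -[1]/(1%:~R) -intrD floorD1_gt.
exists (Num.min d (Num.min (t - m%:~R) (m%:~R + 1 - t))).
  by rewrite !lt_min d0 !subr_gt0 mt tm.
move=> k /andP[k0]; rewrite ltnS leq_eqVlt => /predU1P[->|kN] [n].
  rewrite !lt_min => /and3P[_ tn1 tn2].
  have [nm|mn] := leP n m.
    have : n%:~R <= m%:~R :> R by rewrite ler_int.
    by move: tn1; rewrite -/t ltr_norml => /andP[_]; lra.
  have : m%:~R + 1 <= n%:~R :> R by rewrite -[1]/(1%:~R) -intrD ler_int lezD1.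
  by move: tn2; rewrite -/t ltr_norml => /andP[]; lra.
rewrite lt_min => /andP[kn _]; apply: (dN k); first by rewrite k0.
by exists n.
Qed.

(** * Coordinates in a lattice basis *)

Lemma area_form_le (R : realType) (z w : C R) : `|area_form z w| <= `|z| * `|w|.
Proof.
rewrite -ler_sqr ?nnegrE ?mulr_ge0// exprMn !normC_sqr real_normK ?num_real//.
rewrite /area_form; set a := complex.Re z; set b := complex.Im z.
by rewrite -subr_ge0; have := sqr_ge0 (a * complex.Re w + b * complex.Im w); nra.
Qed.

Lemma area_form_neq0 (R : realType) (w1 w2 : C R) :
  (forall a b : R, a *: w1 + b *: w2 = 0 -> a = 0 /\ b = 0) ->
  area_form w1 w2 != 0.
Proof.
move=> free; apply/eqP; case: w1 w2 free => [a b] [c d]; rewrite /area_form/= => free abcd.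
have [] := free d (- b).
  rewrite /GRing.scale/= /GRing.add/=; congr Complex; lra.
have [] := free c (- a).
  rewrite /GRing.scale/= /GRing.add/=; congr Complex; lra.
move=> c0 /eqP; rewrite oppr_eq0 => /eqP a0 d0 /eqP; rewrite oppr_eq0 => /eqP b0.
have [] := free 1 1.
  by rewrite a0 b0 c0 d0 /GRing.scale/= /GRing.add/= !mulr0 addr0.
by move/eqP; rewrite oner_eq0.
Qed.

(** Cramer's formulas for the coordinates in the basis (w1, w2); on the lattice
    they take integer values. *)
Definition coord1 (R : realType) (w1 w2 z : C R) : R :=
  area_form z w2 / area_form w1 w2.
Definition coord2 (R : realType) (w1 w2 z : C R) : R :=
  area_form w1 z / area_form w1 w2.

Section coordinates.
Context {R : realType}.
Variables w1 w2 : C R.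
Hypothesis w12 : area_form w1 w2 != 0.

Lemma coord1_comb (a b : R) : coord1 w1 w2 (a *: w1 + b *: w2) = a.
Proof. by move: w12; rewrite /coord1 /area_form !ReImE => ?; field. Qed.

Lemma coord2_comb (a b : R) : coord2 w1 w2 (a *: w1 + b *: w2) = b.
Proof. by move: w12; rewrite /coord2 /area_form !ReImE => ?; field. Qed.

Lemma coord1B (z w : C R) : coord1 w1 w2 (z - w) = coord1 w1 w2 z - coord1 w1 w2 w.
Proof. by rewrite /coord1 /area_form !ReImB; ring. Qed.

Lemma coord2B (z w : C R) : coord2 w1 w2 (z - w) = coord2 w1 w2 z - coord2 w1 w2 w.
Proof. by rewrite /coord2 /area_form !ReImB; ring. Qed.

Lemma coord1Z (a : R) (z : C R) : coord1 w1 w2 (a *: z) = a * coord1 w1 w2 z.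
Proof. by rewrite /coord1 /area_form !ReImE; ring. Qed.

(** A common Lipschitz constant for the two coordinates. *)
Definition coord_bound : R := (`|w1| + `|w2|) / `|area_form w1 w2|.

Lemma coord_bound_ge0 : 0 <= coord_bound.
Proof. by rewrite divr_ge0// addr_ge0. Qed.

Lemma coord1_le (z : C R) : `|coord1 w1 w2 z| <= coord_bound * `|z|.
Proof.
rewrite /coord1 /coord_bound normrM normfV mulrAC ler_pM2r ?invr_gt0 ?normr_gt0//.
by rewrite (le_trans (area_form_le _ _))// mulrC ler_wpM2r// lerDr.
Qed.

Lemma coord2_le (z : C R) : `|coord2 w1 w2 z| <= coord_bound * `|z|.
Proof.
rewrite /coord2 /coord_bound normrM normfV mulrAC ler_pM2r ?invr_gt0 ?normr_gt0//.
by rewrite (le_trans (area_form_le _ _))// ler_wpM2r// lerDl.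
Qed.

End coordinates.

(** * Returns of the line to a small ball *)

(** A measurable outer approximation, in terms of coordinates, of the set of
    points at which the line is close to x in the torus.  The first two
    conditions give a set of density O(d^2); the third one, where the slope
    enters, makes the density o(d^2). *)
Definition visits (R : realType) (w1 w2 : C R) (lam : R) (x : C2 R) (d : R)
    : set (R * R) :=
  [set p | [/\ near_int d (coord1 w1 w2 (toC p) - coord1 w1 w2 x.1),
               near_int d (coord2 w1 w2 (toC p) - coord2 w1 w2 x.1)
             & near_int d (lam * coord1 w1 w2 (toC p) - coord1 w1 w2 x.2)]].

Section visits.
Context {R : realType}.
Local Notation T2 := (measurableTypeR R * measurableTypeR R)%type.
Variables (w1 w2 : C R) (lam : R).
Hypothesis w12 : area_form w1 w2 != 0.

Let L := [set z | exists m n : int, z = w1 *~ m + w2 *~ n].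

Lemma torus_ball_visits (x : C2 R) (e d : R) (p : R * R) :
  0 < e -> coord_bound w1 w2 * e < d ->
  torus_ball L x e (toC p, lam *: toC p) -> visits w1 w2 lam x d p.
Proof.
move=> e0 Ked [[l1 l2] [/= [m1 [n1 ->]] [m2 [n2 ->]]]] /=.
set u := _ - _ - _; set v := _ - _ - _ => uv.
have bnd : forall z : C R, `|z| ^+ 2 < e ^+ 2 -> coord_bound w1 w2 * `|z| < d.
  move=> z; rewrite ltr_pXn2r ?nnegrE ?(ltW e0)// => /ltW ze.
  by apply: le_lt_trans Ked; rewrite ler_wpM2l// coord_bound_ge0.
have ud : coord_bound w1 w2 * `|u| < d.
  by apply: bnd; apply: le_lt_trans uv; rewrite lerDl sqr_ge0.
have vd : coord_bound w1 w2 * `|v| < d.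
  by apply: bnd; apply: le_lt_trans uv; rewrite lerDr sqr_ge0.
have Lz m n : (w1 *~ m + w2 *~ n) = m%:~R *: w1 + n%:~R *: w2 by rewrite !scaler_int.
split; [exists m1|exists n1|exists m2].
- by apply: le_lt_trans ud; have := coord1_le w12 u; rewrite /u !coord1B Lz coord1_comb.
- by apply: le_lt_trans ud; have := coord2_le w12 u; rewrite /u !coord2B Lz coord2_comb.
- by apply: le_lt_trans vd; have := coord1_le w12 v;
    rewrite /v !coord1B Lz coord1_comb// coord1Z.
Qed.

Lemma measurable_visits (x : C2 R) (d : R) :
  measurable (visits w1 w2 lam x d : set T2).
Proof.
have mlin (f : C R -> R) (a b c : R) :
    (forall p, f (toC p) = a * p.1 + b * p.2) ->
    measurable ([set p | near_int d (f (toC p) - c)] : set T2).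
  move=> fE; rewrite -[X in measurable X]setTI.
  suff mf : measurable_fun setT ((fun p => f (toC p) - c) : T2 -> measurableTypeR R).
    exact: (mf measurableT _ (measurable_near_int d)).
  under [X in measurable_fun _ X]eq_fun do rewrite fE.
  apply: measurable_funD; last exact: measurable_cst.
  by apply: measurable_funD; apply: measurable_funM => //.
pose D := area_form w1 w2.
have -> : visits w1 w2 lam x d =
  [set p | near_int d (coord1 w1 w2 (toC p) - coord1 w1 w2 x.1)] `&`
  [set p | near_int d (coord2 w1 w2 (toC p) - coord2 w1 w2 x.1)] `&`
  [set p | near_int d (lam * coord1 w1 w2 (toC p) - coord1 w1 w2 x.2)].
  by apply/seteqP; split=> p; [case|case; case].
apply: measurableI; first apply: measurableI.
- apply: (mlin _ (complex.Im w2 / D) (- complex.Re w2 / D)) => p.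
  by rewrite /coord1 -/D /area_form/=; field.
- apply: (mlin _ (- complex.Im w1 / D) (complex.Re w1 / D)) => p.
  by rewrite /coord2 -/D /area_form/=; field.
- apply: (mlin (fun z => lam * _ z)
    (lam * (complex.Im w2 / D)) (lam * (- complex.Re w2 / D))) => p.
  by rewrite /coord1 -/D /area_form/=; field.
Qed.

End visits.

Section packing.
Context {R : realType}.
Variables (w1 w2 : C R) (lam : R).
Hypothesis w12 : area_form w1 w2 != 0.

(** The translates by u i, where i = (i1, i2, k) stands for the shift
    2 d i1 w1 + 2 d i2 w2 + k w1, are pairwise disjoint. *)
Lemma visits_packing (x : C2 R) (d r : R) (J N : nat) :
  (forall k : nat, (0 < k < N)%N -> ~ near_int (2 * d) (lam * k%:R)) ->
  0 < d -> J%:R * (2 * d) <= 2^-1 -> 0 < r ->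
  ((J * J * N)%:R%:E * @mu2 R (visits w1 w2 lam x d `&` disc r) <=
   @mu2 R (disc (r + ((1 + N%:R) * `|w1| + `|w2|))))%E.
Proof.
move=> lamN d0 Jd r0; set M := _ * `|w1| + `|w2|.
have M0 : 0 <= M by rewrite addr_ge0 ?mulr_ge0 ?addr_ge0.
pose I := ('I_J * 'I_J * 'I_N)%type.
pose u (i : I) : C R :=
  (i.1.1%:R * (2 * d) + i.2%:R) *: w1 + (i.1.2%:R * (2 * d)) *: w2.
pose s (i : I) : R * R := (complex.Re (u i), complex.Im (u i)).
have toCs (p : R * R) i : toC (p.1 + (s i).1, p.2 + (s i).2) = toC p + u i.
  by rewrite /toC /s /=; case: (u i).
have c1 p i : coord1 w1 w2 (toC p + u i) =
    coord1 w1 w2 (toC p) + (i.1.1%:R * (2 * d) + i.2%:R).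
  by rewrite -[u i]opprK coord1B -[- u i]sub0r coord1B coord1_comb// /coord1 /area_form/=;
    ring.
have c2 p i : coord2 w1 w2 (toC p + u i) =
    coord2 w1 w2 (toC p) + i.1.2%:R * (2 * d).
  by rewrite -[u i]opprK coord2B -[- u i]sub0r coord2B coord2_comb// /coord2 /area_form/=;
    ring.
have ub i : `|u i| <= M.
  have grid (k : 'I_J) : `|k%:R * (2 * d)| <= 1.
    rewrite ger0_norm; last by rewrite mulr_ge0 ?mulr_ge0 ?(ltW d0).
    apply: (@le_trans _ _ (J%:R * (2 * d))).
      by rewrite ler_pM2r ?mulr_gt0// ler_nat ltnW.
    by apply: le_trans Jd _; lra.
  rewrite (le_trans (ler_normD _ _))// (normrZ _ w1) (normrZ _ w2) lerD//.
    rewrite ler_wpM2r// (le_trans (ler_normD _ _))// lerD ?grid// normr_nat.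
    by rewrite ler_nat ltnW.
  by rewrite ler_piMl// grid.
have -> : (J * J * N)%:R%:E = #|{: I}|%:R%:E :> \bar R by rewrite !card_prod !card_ord.
apply: (@mu2_packing R _ s).
- by apply: measurableI; [exact: measurable_visits|exact: measurable_disc].
- by apply: measurable_disc; rewrite ltr_wpDr.
- move=> i j p [Vi _] [Vj _].
  have [i1 i2 i3] := Vi; have [j1 j2 j3] := Vj.
  rewrite !toCs !c1 !c2 in i1 i2 i3 j1 j2 j3.
  (* The part [i.2%:R] of the shift along w1 is an integer: modulo the integers
     the first coordinate only sees [i.1.1]. *)
  have e1 : i.1.1 = j.1.1.
    apply: val_inj; apply: (near_int_grid (n := i.2%:Z - j.2%:Z) Jd);
      rewrite /= ?ltn_ord//.
    apply: (eq_ind _ (near_int (2 * d)) (near_int_sub i1 j1)); rewrite intrB; ring.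
  have e2 : i.1.2 = j.1.2.
    apply: val_inj; apply: (near_int_grid (n := 0) Jd); rewrite /= ?ltn_ord//.
    apply: (eq_ind _ (near_int (2 * d)) (near_int_sub i2 j2)); ring.
  have e3 : i.2 = j.2.
    (* Say i.2 < j.2: then lam (j.2 - i.2) would be close to an integer. *)
    apply: val_inj; rewrite /= e1 in i3.
    case: (ltngtP i.2 j.2) => // kl; exfalso.
      apply: (lamN (j.2 - i.2)%N); first by have := ltn_ord j.2; lia.
      apply: (eq_ind _ (near_int (2 * d)) (near_int_sub j3 i3)).
      by rewrite natrB ?(ltnW kl)//; ring.
    apply: (lamN (i.2 - j.2)%N); first by have := ltn_ord i.2; lia.
    apply: (eq_ind _ (near_int (2 * d)) (near_int_sub i3 j3)).
    by rewrite natrB ?(ltnW kl)//; ring.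
  by case: i j e1 e2 e3 {Vi Vj i1 i2 i3 j1 j2 j3} => [[? ?] ?] [[? ?] ?] /= -> -> ->.
- move=> i p [_]; rewrite /disc/= toCs => pr.
  have -> : toC p = toC p + u i - u i by rewrite addrK.
  by rewrite (le_lt_trans (ler_normB _ _))// ltr_leD.
Qed.

(** Here J is of order 1 / (4 d).  The constant is 16 * 64: for r >= M the disc
    of radius r + M has at most 16 times the area of the disc of radius r, and
    J >= 1 / (8 d). *)
Lemma visits_density (x : C2 R) (d : R) (N : nat) :
  (0 < N)%N -> (forall k : nat, (0 < k < N)%N -> ~ near_int (2 * d) (lam * k%:R)) ->
  0 < d -> 4 * d <= 1 ->
  exists2 M : R, 0 < M & forall r, M <= r ->
    fine (@mu2 R (visits w1 w2 lam x d `&` disc r)) <=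
    1024 * d ^+ 2 / N%:R * fine (@mu2 R (disc r)).
Proof.
move=> N0 lamN d0 d1.
pose J := Num.truncn (4 * d)^-1.
have d41 : 1 <= (4 * d)^-1 by rewrite -[leLHS]invr1 lef_pV2 ?posrE//; lra.
have /andP[JLe Jgt] : J%:R <= (4 * d)^-1 < J.+1%:R by apply: truncn_itv; lra.
have J1 : 1 <= J%:R :> R by rewrite ler1n truncn_gt0.
have d20 : 0 <= 2 * d by lra.
have Jd : J%:R * (2 * d) <= 2^-1.
  have := ler_wpM2r d20 JLe; suff -> : (4 * d)^-1 * (2 * d) = 2^-1 by [].
  by field; rewrite gt_eqF.
have d40 : 0 < 4 * d by lra.
have Jd' : 1 <= J%:R * (8 * d).
  have := ler_wpM2r (ltW d40) (ltW Jgt).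
  by rewrite mulVf ?gt_eqF// -natr1; nra.
have n0 : 0 < N%:R :> R by rewrite ltr0n.
exists ((1 + N%:R) * `|w1| + `|w2| + 1).
  by rewrite ltr_wpDl// addr_ge0 ?mulr_ge0 ?addr_ge0.
set M := _ + `|w2| => r Mr.
have M0 : 0 <= M by rewrite addr_ge0 ?mulr_ge0 ?addr_ge0.
have r0 : 0 < r by lra.
have := visits_packing x lamN d0 Jd r0; rewrite -/M => pack.
set V := visits _ _ _ _ _ `&` _ in pack *.
have Vfin : @mu2 R V \is a fin_num.
  by apply: mu2_setI_disc_fin_num => //; exact: measurable_visits.
have Dge : r ^+ 2 <= fine (@mu2 R (disc r)).
  by rewrite -lee_fin fineK ?mu2_disc_fin_num// mu2_disc_ge.
have {}pack : (J * J * N)%:R * fine (@mu2 R V) <= (2 * (r + M)) ^+ 2.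
  rewrite -lee_fin EFinM fineK//; apply: le_trans pack _.
  by rewrite mu2_disc_le// ltr_wpDr.
set v := fine (@mu2 R V) in pack *; set D := fine (@mu2 R (disc r)) in Dge *.
have v0 : 0 <= v by rewrite fine_ge0// measure_ge0.
rewrite mulrAC ler_pdivlMr// !natrM in pack *.
have : (2 * (r + M)) ^+ 2 <= 16 * D by nra.
move=> /(le_trans pack) => JJ.
have J2 : 1 <= (J%:R * (8 * d)) ^+ 2 by rewrite exprn_ege1.
have vN : 0 <= v * N%:R by rewrite mulr_ge0// ltW.
have d64 : 0 <= 64 * d ^+ 2 by rewrite mulr_ge0// sqr_ge0.
have := ler_wpM2r vN J2; have := ler_wpM2l d64 JJ.
nra.
Qed.

End packing.

(** * Lelong numbers of the Ahlfors currents *)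

Section ahlfors.
Context {R : realType}.
Variables (L : set (C R)) (w1 w2 : C R) (lam : R).
Hypothesis w12 : area_form w1 w2 != 0.
Hypothesis LE : L = [set z | exists m n : int, z = w1 *~ m + w2 *~ n].
Local Notation F := (fun z : C R => (z, lam *: z)).
(* One more than the Lipschitz constant, to have a strict inequality in
   [torus_ball_visits] and a positive K. *)
Local Notation K := (coord_bound w1 w2 + 1).

Let c : R := pi^-1 * (1 + lam ^+ 2).

Let c_gt0 : 0 < c.
Proof. by rewrite mulr_gt0 ?invr_gt0 ?pi_gt0// ltr_wpDr// sqr_ge0. Qed.

Lemma area_line (r : R) : 0 < r -> area F r = c * fine (@mu2 R (disc r)).
Proof.
move=> r0; rewrite /area /disc_current /integral_form -Rintegral_cst; last first.
  exact: measurable_disc.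
apply: eq_Rintegral => p _; rewrite -[RHS]mul1r -(pullback_omegaA _ (fun=> 1) (toC p)).
by rewrite /pullback mul1r.
Qed.

Lemma area_line_gt0 (r : R) : 0 < r -> 0 < area F r.
Proof.
move=> r0; rewrite area_line// mulr_gt0//.
apply: (@lt_le_trans _ _ (r ^+ 2)); first by rewrite exprn_gt0.
by rewrite -lee_fin fineK ?mu2_disc_fin_num// mu2_disc_ge.
Qed.

Lemma disc_current_le (chi : C2 R -> R) (x : C2 R) (e r : R) :
  0 < e -> 0 < r -> (forall p, 0 <= chi p <= 1) ->
  [set p | chi p != 0] `<=` torus_ball L x e ->
  disc_current F r (fun p v w => chi p * omegaA p v w) <=
  c * fine (@mu2 R (visits w1 w2 lam x (K * e) `&` disc r)).
Proof.
move=> e0 r0 chi01 chix; rewrite /disc_current /integral_form.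
set V := visits _ _ _ _ _.
have mV : measurable (V : set (measurableTypeR R * measurableTypeR R)).
  exact: measurable_visits.
have mD := measurable_disc r0.
have VD : (\int[@mu2 R]_(p in disc r) (c * \1_V p)%:E = c%:E * @mu2 R (V `&` disc r))%E.
  rewrite -integral_indic// -ge0_integralZl_EFin//.
  - by apply/measurable_EFinP; exact: measurable_indic.
  - exact: ltW.
have VDfin := mu2_setI_disc_fin_num r0 mV.
rewrite /Rintegral -[leRHS]/(fine c%:E * _) -fineM// -VD.
have chic p : 0 <= chi (toC p, lam *: toC p) * c.
  by rewrite mulr_ge0 ?(ltW c_gt0)//; case/andP: (chi01 (toC p, lam *: toC p)).
have le : (\int[@mu2 R]_(p in disc r)
    (pullback F (fun p v w => chi p * omegaA p v w) (toC p) 1 (iC R))%:E <=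
    \int[@mu2 R]_(p in disc r) (c * \1_V p)%:E)%E.
  apply: ge0_le_integral_nomeas => p _; rewrite pullback_omegaA lee_fin//.
  rewrite mulrC ler_wpM2l ?(ltW c_gt0)// indicE.
  have /andP[_ chi1] := chi01 (toC p, lam *: toC p).
  case: (boolP (p \in V)) => //; rewrite notin_setE => pV.
  rewrite leNgt; apply/negP => chi0; apply: pV.
  have := chix (toC p, lam *: toC p); rewrite /= gt_eqF// LE => /(_ isT).
  by apply: torus_ball_visits => //; rewrite ltr_pM2r// ltrDl.
have ge : (0 <= \int[@mu2 R]_(p in disc r)
    (pullback F (fun p v w => chi p * omegaA p v w) (toC p) 1 (iC R))%:E)%E.
  by apply: integral_ge0 => p _; rewrite pullback_omegaA lee_fin.
apply: fine_le => //; last by rewrite VD fin_numM.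
rewrite ge0_fin_numE// (le_lt_trans le)// VD.
by rewrite -ge0_fin_numE ?fin_numM// mule_ge0// ?measure_ge0// lee_fin ltW.
Qed.

(** As T is a weak limit of normalized discs, the bound of [visits_density] on
    the time spent near x passes to T (chi omega) for every cutoff chi. *)
Lemma trace_mass_le (T : functional R) (x : C2 R) (e : R) (N : nat) :
  ahlfors_current L F T -> 0 < e -> (0 < N)%N ->
  (forall k : nat, (0 < k < N)%N -> ~ near_int (2 * (K * e)) (lam * k%:R)) ->
  4 * (K * e) <= 1 ->
  0 <= trace_mass L T (torus_ball L x e) <= 1024 * (K * e) ^+ 2 / N%:R.
Proof.
move=> [[[Tlin _] _ _ _] [r [r0 _ roo _ Tlim]]] e0 N0 lamN d1.
set d := K * e; set B := 1024 * d ^+ 2 / N%:R.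
have d0 : 0 < d by rewrite mulr_gt0// ltr_wpDl// coord_bound_ge0.
have [M M0 dens] := visits_density w12 x N0 lamN d0 d1.
rewrite /trace_mass; set S := (X in sup X).
have SB : ubound S B.
  move=> _ [chi [test chi01 supp ->]].
  apply: (cvgr_to_le (Tlim _ (test_form2_omegaA test))).
  near=> n.
  have Mn : M <= r n by near: n; move/cvgryPge : roo; exact.
  rewrite ler_pdivrMr ?area_line_gt0//.
  apply: le_trans (disc_current_le e0 (r0 n) chi01 _) _.
    exact: subset_trans (@subset_closure _ _) supp.
  by rewrite area_line// mulrCA ler_pM2l// dens.
(* The supremum is only controlled by upper bounds if S is nonempty: take
   chi = 0, for which additivity of T gives T 0 = T 0 + T 0. *)
have S0 : S 0.
  have test0 : test_fun L (fun=> 0 : R).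
    split=> //; elim=> [|n IH]; split; do ?[exact: cst_continuous]; first by [].
    move=> v; split; first by move=> y; exact: derivable_cst.
    by apply: (eq_ind _ (Ck n) IH); apply/funext => y; rewrite derive_cst.
  exists (fun=> 0); split=> // [p|p|].
  - by rewrite lexx ler01.
  - suff -> : [set p : C2 R | (0 : R) != 0] = set0 by rewrite closure0.
    by apply/seteqP; split=> y //=; rewrite eqxx.
  - have := Tlin 1 _ _ (test_form2_omegaA test0) (test_form2_omegaA test0).
    under eq_fun do under eq_fun do under eq_fun do rewrite mul0r mulr0 addr0.
    under [X in _ = _ * T X + T X -> _]eq_fun
      do under eq_fun do under eq_fun do rewrite mul0r.
    under [X in _ -> _ = T X]eq_fun do under eq_fun do under eq_fun do rewrite mul0r.
    by move=> /eqP; rewrite mul1r -subr_eq0 opprD addNKr oppr_eq0 => /eqP.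
apply/andP; split; first by apply: ub_le_sup => //; exists B.
by apply: ge_sup; first by exists 0.
Unshelve. all: by end_near. Qed.

(** Choose N first, large with respect to the required precision, and only then
    e, small enough for lam, ..., (N - 1) lam to be far from the integers at the
    scale of e. *)
Lemma lelong_eq0 (T : functional R) (x : C2 R) :
  irrational lam -> ahlfors_current L F T -> lelong L T x = 0.
Proof.
move=> lamQ ahl; apply: cvg_lim => //.
apply/cvgrPdist_le => eta eta0.
have K0 : 0 < K by rewrite ltr_wpDl// coord_bound_ge0.
pose N := (Num.truncn (1024 * K ^+ 2 / eta)).+1.
have N0 : 0 < N%:R :> R by rewrite ltr0n.
have NK : 1024 * K ^+ 2 / N%:R <= eta.
  by rewrite ler_pdivrMr// -ler_pdivrMl// mulrC ltW// truncnS_gt.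
have [d0 d00 dN] := irrational_multiples_away N lamQ.
near=> e.
have e0 : 0 < e by near: e; exact: nbhs_right_gt.
have ed0 : e < d0 / (2 * K).
  by near: e; apply: nbhs_right_lt; rewrite divr_gt0// mulr_gt0.
have e1 : e < 1 / (4 * K).
  by near: e; apply: nbhs_right_lt; rewrite divr_gt0// mulr_gt0.
rewrite ltr_pdivlMr ?mulr_gt0// in ed0; rewrite ltr_pdivlMr ?mulr_gt0// in e1.
have lamN k : (0 < k < N)%N -> ~ near_int (2 * (K * e)) (lam * k%:R).
  move=> /dN; apply: contra_not; apply: near_int_le; lra.
have d1 : 4 * (K * e) <= 1 by lra.
have /andP[m0 m1] := trace_mass_le x ahl e0 (isT : (0 < N)%N) lamN d1.
rewrite sub0r normrN ger0_norm ?divr_ge0 ?sqr_ge0// ler_pdivrMr ?exprn_gt0//.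
apply: le_trans m1 _; rewrite exprMn mulrA mulrAC.
by rewrite ler_wpM2r ?sqr_ge0.
Unshelve. all: by end_near. Qed.

End ahlfors.

Theorem proposition7p1 (R : realType) (L : set (C R)) (lam : R)
    (T : functional R) :
  is_lattice L -> irrational lam ->
  ahlfors_current L (fun z : C R => (z, lam *: z)) T ->
  diffuse L T.
Proof.
move=> [w1 [w2 [/area_form_neq0 w12 LE]]] lamQ ahl.
exists (fun=> 0), T; split=> //; split; first by move=> eta _; rewrite add0r.
split.
  exists set0, (fun=> 1), (fun=> set0), (fun=> fun=> 0); split=> // eta _.
  rewrite [X in X @ _ --> _](_ : _ = fun=> 0); first exact: cvg_cst.
  by apply/funext => n; rewrite big_pred0// => l; rewrite in_set0.
split; first by case: ahl.
move=> Z [_ [[x Zx] _] _]; rewrite /lelong_along.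
rewrite [X in inf X](_ : _ = [set 0]) ?inf1//.
apply/seteqP; split=> [_ [y _ <-]|_ ->].
  by rewrite (lelong_eq0 w12 LE y lamQ ahl).
by exists x => //; exact: (lelong_eq0 w12 LE x lamQ ahl).
Qed.
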